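(* Let $n\ge 6$ be an integer. Every strongly group-strategyproof mechanism for constrained facility location in graphs with $n$ agents has infinite approximation ratio with respect to the maximum cost objective and also with respect to the total cost objective. That is, if $M$ is such a mechanism, then for each of the two objectives $c\in\{c_{\max},c_{\mathrm{tot}}\}$ there is no finite $\rho$ such that $c(M(G,F,x);G,x)\le\rho\cdot\min_{f\in F}c(f;G,x)$ for all instances $(G,F,x)$.
   Context: An instance of constrained facility location in graphs consists of a finite connected undirected graph $G=(V,E)$, a nonempty set $F\subseteq V$ of allowable nodes, and a profile $x=(x_1,\dots,x_n)\in V^n$ of reported agent locations (agents may be located at any node, not only nodes of $F$). Let $d_G$ be the shortest-path distance in $G$. A (deterministic) mechanism is a function $M$ that assigns to every instance $(G,F,x)$ an allowable node $M(G,F,x)\in F$ at which the facility is placed. The graph $G$ and the set $F$ are public; locations are private. The maximum cost of a node $f$ is $c_{\max}(f;G,x)=\max_i d_G(f,x_i)$ and the total cost is $c_{\mathrm{tot}}(f;G,x)=\sum_i d_G(f,x_i)$. $M$ is strongly group-strategyproof if for every $G$, $F$, location profile $x$ and coalition $S$ of agents, there are no reports $x'_S=(x'_i)_{i\in S}$ such that $d_G(x_i,M(G,F,(x'_S,x_{-S})))\le d_G(x_i,M(G,F,x))$ for every $i\in S$, with strict inequality for at least one $i\in S$. Here $(x'_S,x_{-S})$ is the profile obtained from $x$ by replacing $x_i$ by $x'_i$ for $i\in S$. *)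

(* Defs.v *)
From HB Require Import structures.
From mathcomp Require Import all_boot all_order all_algebra reals.

Set Implicit Arguments.
Unset Strict Implicit.
Unset Printing Implicit Defensive.

Import Order.TTheory GRing.Theory Num.Theory.

Record cgraph := CGraph {
  vertex :> finType;
  adj : rel vertex;
  adj_sym : symmetric adj;
  adj_irr : irreflexive adj;
  adj_connected : forall u v : vertex, connect adj u v
}.

Definition has_walk (G : cgraph) (u v : G) (k : nat) : bool :=
  [exists p : k.-tuple G, path (@adj G) u p && (last u p == v)].

Lemma has_walk_ex (G : cgraph) (u v : G) : exists k, has_walk u v k.
Proof.
have /connectP[p pth ->] := adj_connected u v.
by exists (size p); apply/existsP; exists (in_tuple p); rewrite /= pth eqxx.
Qed.

Definition gdist (G : cgraph) (u v : G) : nat := ex_minn (has_walk_ex u v).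

Record allowable (G : cgraph) := Allowable {
  allowed :> {set G};
  allowed_neq0 : allowed != set0
}.

Definition profile (n : nat) (G : cgraph) := {ffun 'I_n -> G}.

Record mechanism (n : nat) := Mechanism {
  outcome :> forall G : cgraph, allowable G -> profile n G -> G;
  outcome_allowed :
    forall (G : cgraph) (F : allowable G) (x : profile n G), outcome F x \in allowed F
}.

Definition objective (n : nat) := forall G : cgraph, profile n G -> G -> nat.

Definition max_cost (n : nat) : objective n :=
  fun G x f => \max_(i < n) gdist f (x i).

Definition total_cost (n : nat) : objective n :=
  fun G x f => \sum_(i < n) gdist f (x i).

Definition some_allowed (G : cgraph) (F : allowable G) : G :=
  xchoose (elimT (set0Pn (allowed F)) (allowed_neq0 F)).

(* The starting point [some_allowed F] of [arg min] only witnesses that F is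
   nonempty; the minimum value does not depend on it. *)
Definition opt_cost (n : nat) (c : objective n) (G : cgraph) (F : allowable G)
    (x : profile n G) : nat :=
  c G x [arg min_(f < some_allowed F in allowed F) c G x f].

(* The profile (x'_S, x_{-S}); the entries of [x'] outside S are ignored. *)
Definition deviate (n : nat) (G : cgraph) (S : {set 'I_n}) (x' x : profile n G) :
    profile n G :=
  [ffun i => if i \in S then x' i else x i].

Definition strongly_group_strategyproof (n : nat) (M : mechanism n) : Prop :=
  forall (G : cgraph) (F : allowable G) (x : profile n G) (S : {set 'I_n}),
  ~ exists x' : profile n G,
      (forall i, i \in S ->
         gdist (x i) (M G F (deviate S x' x)) <= gdist (x i) (M G F x)) /\
      (exists2 i, i \in S &
         gdist (x i) (M G F (deviate S x' x)) < gdist (x i) (M G F x)).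

(* Stated multiplicatively, so that when the optimal cost is 0 the cost of the
   outcome must be 0 as well. *)
Definition approximates (R : realType) (n : nat) (M : mechanism n)
    (c : objective n) (rho : R) : Prop :=
  forall (G : cgraph) (F : allowable G) (x : profile n G),
  ((c G x (M G F x))%:R <= rho * (opt_cost c F x)%:R)%R.

Definition infinite_approximation_ratio (R : realType) (n : nat)
    (M : mechanism n) (c : objective n) : Prop :=
  ~ exists rho : R, approximates M c rho.

(* Main.v *)
(** A finite ratio forces unanimity: if all agents sit at an allowable node, that
    node is chosen; strong group-strategyproofness then yields Pareto optimality.
    On the cycle of length 12 with three equidistant allowable nodes a, b, c, all
    strict rankings of a, b, c and all ties for the first place occur.  Put agent
    i at a > b > c, agent j at b > a > c and everybody else at a = b > c.  If the
    outcome is a, then the agents other than i cannot enforce b, and moving them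
    to b > c > a shows that they cannot enforce c either, so i enforces a alone.
    Hence for all agents i <> j and nodes a <> b, either i enforces a or j
    enforces b, but never both.  Three agents and three nodes make this
    impossible. *)
Require Import Defs.
From HB Require Import structures.
From mathcomp Require Import all_boot all_order all_algebra reals.
From mathcomp Require Import zify.

Set Implicit Arguments.
Unset Strict Implicit.
Unset Printing Implicit Defensive.

(** * Computing graph distances *)

Lemma gdist_eq0 (G : cgraph) (u v : G) : (gdist u v == 0) = (u == v).
Proof.
rewrite /gdist; case: ex_minnP => k /existsP[p /andP[_ /eqP uv]] kmin.
apply/eqP/eqP => [k0|uv_eq].
  by move: p uv; rewrite k0 => p; rewrite (tuple0 p).
rewrite -uv_eq in kmin.
apply/eqP; rewrite -leqn0; apply: kmin.
by apply/existsP; exists [tuple]; rewrite /= eqxx.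
Qed.

(** Following the descent of [g] gives a walk of length [g u] to [f]; since [g] drops by at most one
    per edge, no walk is shorter. *)
Lemma gdist_potential (G : cgraph) (f : G) (g : G -> nat) :
  g f = 0 -> (forall u, g u = 0 -> u = f) ->
  (forall u v, adj u v -> g u <= (g v).+1) ->
  (forall u, 0 < g u -> exists2 v, adj u v & (g v).+1 = g u) ->
  forall u, gdist u f = g u.
Proof.
move=> gf g0 gLip gdesc u.
have walk k v : g v = k -> has_walk v f k.
  elim: k v => [|k IHk] v gv.
    by rewrite (g0 v gv); apply/existsP; exists [tuple]; rewrite /= eqxx.
  have [|w vw] := gdesc v; first by rewrite gv.
  rewrite gv => -[/IHk /existsP[p /andP[wp pf]]].
  by apply/existsP; exists (cons_tuple w p); rewrite /= vw wp pf.
rewrite /gdist; case: ex_minnP => k /existsP[p /andP[up /eqP pf]] kmin.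
apply/eqP; rewrite eqn_leq kmin ?walk //=.
have path_ge s v : path (@adj G) v s -> g v <= g (last v s) + size s.
  elim: s v => [|w s IHs] v /=; first by rewrite addn0.
  by case/andP=> /gLip vw /IHs; lia.
by have := path_ge _ _ up; rewrite pf gf size_tuple.
Qed.

(** * Consequences of strong group-strategyproofness *)

Section Mechanism.

Variables (n : nat) (M : mechanism n).
Hypothesis sgsp : strongly_group_strategyproof M.

(* The deviating coalition consists of all agents who do not lose. *)
Lemma sgsp_no_gain (G : cgraph) (F : allowable G) (x y : profile n G) i :
  gdist (x i) (M G F y) < gdist (x i) (M G F x) ->
  ~ forall k, y k = x k \/ gdist (x k) (M G F y) <= gdist (x k) (M G F x).
Proof.
move=> gain xy.
pose S := [set j | gdist (x j) (M G F y) <= gdist (x j) (M G F x)].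
have devE : deviate S y x = y.
  apply/ffunP => j; rewrite ffunE inE; case: ifP => // jS.
  by case: (xy j); rewrite ?jS.
case: (@sgsp G F x S); exists y; rewrite devE; split.
  by move=> j; rewrite inE.
by exists i => //; rewrite inE ltnW.
Qed.

Section Enforcement.

Variables (G : cgraph) (F : allowable G).
Hypothesis unanimous : forall f : G, f \in allowed F -> M G F [ffun=> f] = f.

Definition enforces (i : 'I_n) (a : G) : Prop :=
  forall x : profile n G, x i = a -> M G F x = a.

Definition ranks (p a b c : G) : bool :=
  (gdist p a < gdist p b) && (gdist p b < gdist p c).

(** Otherwise all agents could report [f], which unanimity would then select. *)
Lemma pareto (x : profile n G) (f : G) (i : 'I_n) : f \in allowed F ->
  gdist (x i) f < gdist (x i) (M G F x) ->
  ~ forall k, gdist (x k) f <= gdist (x k) (M G F x).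
Proof.
move=> fF gain le_f; case: (@sgsp_no_gain G F x [ffun=> f] i).
  by rewrite unanimous.
by move=> k; right; rewrite unanimous.
Qed.

Lemma enforces_from_outcome (a b c p q : G) (i j : 'I_n) (x : profile n G) :
  allowed F = [set a; b; c] -> ranks p a b c -> ranks q b c a ->
  x i = p -> M G F x = a ->
  (forall k, k != i -> gdist (x k) b <= gdist (x k) a) ->
  j != i -> gdist (x j) b < gdist (x j) a -> enforces i a.
Proof.
move=> FE /andP[pab pbc] /andP[qbc qca] xi xa le_ba ji lt_ba.
have in3 y : [\/ M G F y = a, M G F y = b | M G F y = c].
  have := outcome_allowed M F y; rewrite FE !inE -orbA.
  by case/or3P=> /eqP->; [constructor 1 | constructor 2 | constructor 3].
have bF : b \in allowed F by rewrite FE !inE eqxx orbT.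
pose z : profile n G := [ffun k => if k == i then p else q].
(* Outcome [b] would reward [j] for the move from [x] to [z] and harm no agent other than [i], whose
   report is unchanged. Outcome [c] is dominated by [b], which both [p] and [q] rank above [c]. *)
have za : M G F z = a.
  case: (in3 z) => // zE.
  - case: (@sgsp_no_gain G F x z j); rewrite zE xa // => k; rewrite ffunE.
    by case: (eqVneq k i) => [->|/le_ba]; [left | right].
  - case: (@pareto z b j bF); rewrite zE ?ffunE ?(negPf ji) // => k.
    rewrite ffunE.
    by case: ifP => _; exact: ltnW.
(* In [z] everybody but [i] is at [q], where [a] is the worst node, so any other outcome would be a
   joint gain for them. *)
have enforce_p (y : profile n G) : y i = p -> M G F y = a.
  move=> yi; have lose : ~ gdist q (M G F y) < gdist q a.
    move=> gain; case: (@sgsp_no_gain G F z y j).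
      by rewrite za ffunE (negPf ji).
    move=> k; rewrite za.
    rewrite ffunE; case: (eqVneq k i) => [->|_]; first by left.
    by right; exact: ltnW.
  case: (in3 y) => // yE; case: lose; rewrite yE //.
  exact: ltn_trans qca.
move=> y yi; pose y' : profile n G := [ffun k => if k == i then p else y k].
have y'a : M G F y' = a by apply: enforce_p; rewrite ffunE eqxx.
(* An agent [i] located at [a] could report [p] and bring its distance down to 0. *)
have /eqP aa : gdist a a == 0 by rewrite gdist_eq0.
apply/esym/eqP; rewrite -gdist_eq0 eqn0Ngt; apply/negP => gain.
case: (@sgsp_no_gain G F y y' i); rewrite y'a ?yi ?aa // => k.
by rewrite ffunE; case: (eqVneq k i) => [->|_]; [right; rewrite yi aa | left].
Qed.

Lemma enforces_either (a b c abc bac bca acb t : G) (i j : 'I_n) :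
  allowed F = [set a; b; c] ->
  ranks abc a b c -> ranks bac b a c -> ranks bca b c a -> ranks acb a c b ->
  gdist t a = gdist t b -> gdist t b < gdist t c ->
  i != j -> enforces i a \/ enforces j b.
Proof.
move=> FE rabc rbac rbca racb tab tbc ij.
have [/andP[ab bc] /andP[ba ac]] := (rabc, rbac).
(* The tie at [t] makes the bystanders weakly favour both [b] over [a] and [a] over [b], so either
   outcome can be handled by the same lemma with the roles swapped. *)
pose x : profile n G :=
  [ffun k => if k == i then abc else if k == j then bac else t].
have xi : x i = abc by rewrite ffunE eqxx.
have xj : x j = bac by rewrite ffunE eqxx eq_sym (negPf ij).
have aF : a \in allowed F by rewrite FE !inE eqxx.
have := outcome_allowed M F x; rewrite FE !inE -orbA => /or3P[] /eqP xE.
- left; apply: (enforces_from_outcome FE rabc rbca xi xE _ (j := j)).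
  + move=> k ki; rewrite ffunE (negPf ki); case: ifP => _; last by rewrite tab.
    exact: ltnW.
  + by rewrite eq_sym.
  + by rewrite xj.
- right; have FE' : allowed F = [set b; a; c] by rewrite FE (setUC [set a]).
  apply: (enforces_from_outcome FE' rbac racb xj xE _ (j := i)) => //.
  + move=> k kj; rewrite ffunE (negPf kj); case: ifP => _; last by rewrite tab.
    exact: ltnW.
  + by rewrite xi.
- case: (@pareto x a i aF); rewrite xE ?xi ?(ltn_trans ab bc) // => k.
  rewrite ffunE.
  by case: ifP => _; [|case: ifP => _]; lia.
Qed.

Lemma enforces_inj (i j : 'I_n) (a b : G) :
  i != j -> enforces i a -> enforces j b -> a = b.
Proof.
move=> ij ia jb; pose x : profile n G := [ffun k => if k == i then a else b].
rewrite -(ia x) ?(jb x) // ffunE ?eqxx //.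
by rewrite eq_sym (negPf ij).
Qed.

End Enforcement.
End Mechanism.

(** * The cycle of length 12 *)

Definition cycle12_adj : rel 'I_12 :=
  fun u v => (v == u.+1 %% 12 :> nat) || (u == v.+1 %% 12 :> nat).

Lemma cycle12_sym : symmetric cycle12_adj.
Proof. by move=> u v; rewrite /cycle12_adj orbC. Qed.

Lemma cycle12_irr : irreflexive cycle12_adj.
Proof. by move=> [u ltu]; rewrite /cycle12_adj /=; lia. Qed.

Lemma cycle12_connected (u v : 'I_12) : connect cycle12_adj u v.
Proof.
have to0 (k : nat) (ltk : k < 12) : connect cycle12_adj (Ordinal ltk) ord0.
  elim: k ltk => [|k IHk] ltk.
    by have -> : Ordinal ltk = ord0 by exact: val_inj.
  apply: connect_trans (IHk (ltnW ltk)); apply: connect1.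
  by rewrite /cycle12_adj /= (modn_small ltk) eqxx orbT.
apply: (@connect_trans _ _ ord0); first by case: u.
by rewrite (sym_connect_sym cycle12_sym); case: v.
Qed.

Definition cycle12 : cgraph :=
  CGraph cycle12_sym cycle12_irr cycle12_connected.

Definition node (k : nat) : cycle12 := inord k : 'I_12.

Lemma gdist_cycle12 (k l : nat) : k < 12 -> l < 12 ->
  gdist (node k) (node l) = minn (k - l + (l - k)) (12 - (k - l + (l - k))).
Proof.
move=> ltk ltl.
(* With truncated subtraction [m] is the absolute difference, as one summand vanishes. *)
pose g (u : cycle12) := let m := (u : 'I_12) - l + (l - (u : 'I_12)) in
  minn m (12 - m).
have nodeE m : m < 12 -> nat_of_ord (node m : 'I_12) = m by move=> ?; rewrite inordK.
rewrite (@gdist_potential cycle12 (node l) g); first by rewrite /g nodeE.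
- by rewrite /g nodeE //; lia.
- move=> u; rewrite /g => g0; apply: (@val_inj _ _ 'I_12) => /=.
  by rewrite nodeE //; have := ltn_ord (u : 'I_12); lia.
- move=> u v; rewrite /= /cycle12_adj /g.
  by have := ltn_ord (u : 'I_12); have := ltn_ord (v : 'I_12); lia.
- move=> u gu; have ltu := ltn_ord (u : 'I_12).
  have lt12 m : m %% 12 < 12 by rewrite ltn_mod.
  (* [down] says that stepping to the predecessor, [u + 11] modulo 12, follows a shortest arc to
     [l]. *)
  have [down|up] := boolP ((l < u <= l + 6) || (u + 6 <= l)).
    exists (node ((u + 11) %% 12)); rewrite /= /cycle12_adj /g nodeE //.
    + by lia.
    + by move: gu; rewrite /g; lia.
  exists (node (u.+1 %% 12)); rewrite /= /cycle12_adj /g nodeE //.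
  + by rewrite eqxx.
  + by move: gu; rewrite /g; lia.
Qed.

Lemma cycle12_allowed_neq0 : [set node 0; node 4; node 8] != set0.
Proof. by apply/set0Pn; exists (node 0); rewrite !inE eqxx. Qed.

Definition cycle12_allowable : allowable cycle12 :=
  Allowable cycle12_allowed_neq0.

Lemma sgsp_not_unanimous (n : nat) (M : mechanism n) : 3 <= n ->
  strongly_group_strategyproof M ->
  ~ (forall f, f \in allowed cycle12_allowable ->
       M cycle12 cycle12_allowable [ffun=> f] = f).
Proof.
move=> n3 sgsp unan.
pose i1 : 'I_n := Ordinal (ltnW (ltnW n3)).
pose i2 : 'I_n := Ordinal (ltnW n3).
pose i3 : 'I_n := Ordinal n3.
pose F := cycle12_allowable; pose a := node 0; pose b := node 4; pose c := node 8.
have neq k l : k < 12 -> l < 12 -> k != l -> node k <> node l.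
  move=> ltk ltl /eqP kl E; apply: kl.
  by rewrite -(inordK ltk) -(inordK ltl) [inord k]E.
(* Each odd node is at distances 1, 3 and 5 from the allowable nodes, which yields all six strict
   rankings; nodes 2, 6 and 10 are at distances 2, 2 and 6, which yields the ties. *)
have D12 : enforces M F i1 a \/ enforces M F i2 b.
  by apply: (@enforces_either n M sgsp _ F unan a b c (node 1) (node 3)
    (node 5) (node 11) (node 2)); rewrite /ranks ?gdist_cycle12.
have D23 : enforces M F i2 b \/ enforces M F i3 c.
  by apply: (@enforces_either n M sgsp _ F unan b c a (node 5) (node 7)
    (node 9) (node 3) (node 6)); rewrite /ranks ?gdist_cycle12 // setUC setUA.
have D13 : enforces M F i1 a \/ enforces M F i3 c.
  by apply: (@enforces_either n M sgsp _ F unan a c b (node 11) (node 9)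
    (node 7) (node 1) (node 10)); rewrite /ranks ?gdist_cycle12 // setUAC.
have N12 : enforces M F i1 a -> enforces M F i2 b -> False.
  by move=> e1 e2; apply: (neq 0 4) => //; exact: (enforces_inj _ e1 e2).
have N13 : enforces M F i1 a -> enforces M F i3 c -> False.
  by move=> e1 e3; apply: (neq 0 8) => //; exact: (enforces_inj _ e1 e3).
have N23 : enforces M F i2 b -> enforces M F i3 c -> False.
  by move=> e2 e3; apply: (neq 4 8) => //; exact: (enforces_inj _ e2 e3).
(* Exactly one claim of each pair would hold, but two of three claims share a truth value. *)
by tauto.
Qed.

(** When all agents are at an allowable [f] the optimum is 0, so any finite [rho] forces cost 0,
    which by the first hypothesis only [f] attains. *)
Lemma approximates_unanimous (R : realType) (n : nat) (M : mechanism n)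
    (c : objective n) (rho : R) :
  (forall (G : cgraph) (f g : G), (c G [ffun=> f] g == 0) = (g == f)) ->
  approximates M c rho ->
  forall (G : cgraph) (F : allowable G) (f : G),
    f \in allowed F -> M G F [ffun=> f] = f.
Proof.
move=> c0 approx G F f fF.
have opt0 : opt_cost c F [ffun=> f] = 0.
  rewrite /opt_cost; case: arg_minnP => [|g gF /(_ f fF)].
    exact: (xchooseP (elimT (set0Pn (allowed F)) (allowed_neq0 F))).
  by have /eqP-> : c G [ffun=> f] f == 0; [rewrite c0 | rewrite leqn0 => /eqP].
apply/eqP; rewrite -c0 -leqn0 -(@Num.Theory.ler_nat R).
by have := approx G F [ffun=> f]; rewrite opt0 GRing.mulr0.
Qed.

Lemma max_cost_const (n : nat) (G : cgraph) (f g : G) : 0 < n ->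
  (@max_cost n G [ffun=> f] g == 0) = (g == f).
Proof.
move=> n0; rewrite -gdist_eq0 -!leqn0.
apply/bigmax_leqP/idP => [/(_ (Ordinal n0) isT)|gf i _]; by rewrite ffunE.
Qed.

Lemma total_cost_const (n : nat) (G : cgraph) (f g : G) : 0 < n ->
  (@total_cost n G [ffun=> f] g == 0) = (g == f).
Proof.
move=> n0; rewrite -gdist_eq0 /total_cost.
under eq_bigr do rewrite ffunE.
by rewrite sum_nat_const card_ord muln_eq0 eqn0Ngt n0.
Qed.

Theorem theorem11 (R : realType) (n : nat) (hn : 6 <= n) (M : mechanism n)
    (hM : strongly_group_strategyproof M) :
  infinite_approximation_ratio R M (@max_cost n) /\
  infinite_approximation_ratio R M (@total_cost n).
Proof.
have n3 : 3 <= n by exact: leq_trans hn.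
have n0 : 0 < n by exact: leq_trans hn.
split=> -[rho approx]; apply: (sgsp_not_unanimous n3 hM) => f;
  apply: approximates_unanimous approx _ _ _ => G g h.
- exact: max_cost_const.
- exact: total_cost_const.
Qed.
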